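(* There are infinitely many natural numbers $m$ such that the alternating group $A_m$ satisfies $h_{\rm OD}(A_m)>1$. In particular, there is no upper bound for $h_{\rm OD}(A_m)$ (that is, for every natural number $N$ there is a natural number $m$ with $h_{\rm OD}(A_m)>N$).
   Context: All groups are finite. $A_m$ denotes the alternating group on $m$ letters. For a finite group $G$, $\pi(G)$ is the set of prime divisors of $|G|$. The prime graph $\Gamma(G)$ is the simple graph with vertex set $\pi(G)$ in which two distinct primes $p,q$ are adjacent if and only if $G$ contains an element of order $pq$. For $p\in\pi(G)$, $\deg(p)$ is the number of edges of $\Gamma(G)$ incident with $p$. If $p_1<p_2<\cdots<p_k$ are the prime divisors of $|G|$, the degree pattern of $G$ is ${\rm D}(G)=(\deg(p_1),\deg(p_2),\ldots,\deg(p_k))$. For a finite group $H$, $h_{\rm OD}(H)$ denotes the number of isomorphism classes of finite groups $G$ such that $|G|=|H|$ and ${\rm D}(G)={\rm D}(H)$. *)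

(* Defs.v *)
From mathcomp Require Import all_boot all_order all_fingroup all_solvable.

Set Implicit Arguments.
Unset Strict Implicit.
Unset Printing Implicit Defensive.

Import GroupScope.

Section DegreePattern.

Variables (gT : finGroupType) (G : {group gT}).

Definition prime_graph : rel nat := fun p q =>
  [&& p \in \pi(G), q \in \pi(G), p != q & [exists x in G, #[x] == (p * q)%N]].

Definition pg_degree (p : nat) : nat := count (prime_graph p) (primes #|G|).

(* primes lists the prime divisors in increasing order. *)
Definition degree_pattern : seq nat := [seq pg_degree p | p <- primes #|G|].

End DegreePattern.

Definition same_OD (gT rT : finGroupType) (G : {group gT}) (H : {group rT}) :=
  (#|G| == #|H|) && (degree_pattern G == degree_pattern H).

(* By Cayley's theorem every group of order n is isomorphic to a subgroup of
   'S_n, so the isomorphism classes are counted among these subgroups; hODP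
   below shows that this is the count over all finite groups. *)
Definition hOD (gT : finGroupType) (H : {group gT}) : nat :=
  #|equivalence_partition (fun G K : {group 'S_#|H|} => G \isog K)
      [set G : {group 'S_#|H|} | same_OD G H]|.

(* There are exactly k isomorphism classes of finite groups with the order and
   degree pattern of H: G is a complete irredundant system of representatives. *)
Definition OD_class_count (gT : finGroupType) (H : {group gT}) (k : nat) : Prop :=
  exists (T : 'I_k -> finGroupType) (G : forall i, {group T i}),
    [/\ forall i, same_OD (G i) H,
        forall i j, G i \isog G j -> i = j
      & forall (rT : finGroupType) (K : {group rT}),
          same_OD K H -> exists i, K \isog G i].

Lemma degree_pattern_isog (gT rT : finGroupType) (G : {group gT})
    (H : {group rT}) : G \isog H -> degree_pattern G = degree_pattern H.
Proof.
have half (aT bT : finGroupType) (A : {group aT}) (B : {group bT}) p q :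
    A \isog B -> prime_graph A p q -> prime_graph B p q.
  move=> isoAB; have /isogP[f injf fA] := isoAB.
  case/and4P=> Ap Aq ne_pq /exists_inP[x Ax ox].
  rewrite /prime_graph /= -(card_isog isoAB) Ap Aq ne_pq /=.
  apply/exists_inP; exists (f x); first by rewrite -fA mem_morphim.
  by rewrite order_injm.
move=> isoGH; rewrite /degree_pattern (card_isog isoGH).
apply: eq_map => p; rewrite /pg_degree (card_isog isoGH); apply: eq_count => q.
by apply/idP/idP; apply: half; rewrite // isog_sym.
Qed.

Lemma same_OD_isog (gT rT aT : finGroupType) (G : {group gT}) (K : {group rT})
    (H : {group aT}) : G \isog K -> same_OD G H = same_OD K H.
Proof.
by move=> iso; rewrite /same_OD (card_isog iso) (degree_pattern_isog iso).
Qed.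

Lemma Cayley_ord (gT : finGroupType) (G : {group gT}) (n : nat) :
  #|G| = n -> exists K : {group 'S_n}, G \isog K.
Proof.
move=> oG; have isoG : G \isog [subg G] by apply: isog_subg.
have: #|{: subg_of G}| = n by rewrite -cardsT -oG (card_isog isoG).
suffices Cayley (T : finGroupType) :
    #|T| = n -> exists K : {group 'S_n}, [set: T] \isog K.
  by case/Cayley=> K; exists K; apply: isog_trans isoG _.
move=> <-{n oG}.
pose m (x : T) (i : 'I_#|T|) := enum_rank (enum_val i * x).
have m_inj x : injective (m x).
  by move=> i j /enum_rank_inj/mulIg/enum_val_inj.
pose f (x : T) : 'S_#|T| := perm (@m_inj x).
have fM : {in [set: T] &, {morph f : x y / x * y}}.
  move=> x y _ _; apply/permP=> i.
  by rewrite permM !permE /m enum_rankK mulgA.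
exists (Morphism fM @* [set: T])%G; apply: (sub_isog (subxx _)).
apply/injmP=> x y _ _ /permP/(_ (enum_rank 1)).
by rewrite !permE /m enum_rankK !mul1g => /enum_rank_inj.
Qed.

Lemma OD_class_count_hOD (gT : finGroupType) (H : {group gT}) :
  OD_class_count H (hOD H).
Proof.
pose D := [set G : {group 'S_#|H|} | same_OD G H].
pose R := fun G K : {group 'S_#|H|} => G \isog K.
have eqR : {in D & &, equivalence_rel R}.
  by move=> A B C _ _ _; split; [apply: isog_refl | apply: isog_transl].
pose P := equivalence_partition R D.
have partP : partition P D := equivalence_partitionP eqR.
have trX := transversalP partP; set X := transversal P D in trX.
have ->: hOD H = #|X| by rewrite (card_transversal trX).
have sXD : {subset X <= D} := subsetP (transversal_sub trX).
exists (fun _ => 'S_#|H| : finGroupType), (fun i => enum_val i); split=> [i|i j iso_ij|rT K].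
- by have := sXD _ (enum_valP i); rewrite inE.
- apply/enum_val_inj/(pblock_inj trX); rewrite ?enum_valP //.
  have [Di Dj] := (sXD _ (enum_valP i), sXD _ (enum_valP j)).
  have [/eqP defD tiP _] := and3P partP.
  apply/eqP; rewrite eq_pblock ?defD //.
  by rewrite pblock_equivalence_partition.
move=> odK; have /andP[/eqP oK _] := odK.
have [L isoKL] := Cayley_ord oK.
have DL : L \in D by rewrite inE -(same_OD_isog _ isoKL).
have [/eqP defD tiP _] := and3P partP.
have PL : pblock P L \in P by rewrite pblock_mem ?defD.
have := repr_mem_pblock trX 1%G PL; have := repr_mem_transversal trX 1%G PL.
set M := transversal_repr _ _ _ => XM.
rewrite (pblock_equivalence_partition eqR DL (sXD _ XM)) => isoLM.
exists (enum_rank_in XM M); rewrite enum_rankK_in //.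
exact: isog_trans isoKL isoLM.
Qed.

Lemma OD_class_count_le (gT : finGroupType) (H : {group gT}) k l :
  OD_class_count H k -> OD_class_count H l -> k <= l.
Proof.
move=> [T [G [odG irrG _]]] [U [K [_ _ fullK]]].
pose f i := xchoose (fullK _ _ (odG i)).
rewrite -(card_ord k) -(card_ord l); apply: (@leq_card _ _ f) => i j fij.
apply: irrG; have isoi := xchooseP (fullK _ _ (odG i)).
have isoj := xchooseP (fullK _ _ (odG j)).
rewrite -/(f i) -/(f j) in isoi isoj.
by apply: isog_trans isoi _; rewrite fij isog_sym.
Qed.

Lemma hODP (gT : finGroupType) (H : {group gT}) (k : nat) :
  OD_class_count H k <-> k = hOD H.
Proof.
split=> [cntk | ->]; last exact: OD_class_count_hOD.
have cntH := OD_class_count_hOD H.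
by apply/eqP; rewrite eqn_leq !(@OD_class_count_le _ H).
Qed.

(* Main.v *)
Require Import Defs.
From mathcomp Require Import all_boot all_order all_fingroup all_solvable.
From mathcomp Require Import zmodp.
From mathcomp Require Import zify.

Set Implicit Arguments.
Unset Strict Implicit.
Unset Printing Implicit Defensive.

Import GroupScope.

(** For suitable m, the factor m of #|'Alt_('I_m)| can be split off without
    being noticed by the degree pattern: if K is any group of order m, then
    'Alt_('I_m.-1) * K has the order of 'Alt_('I_m), and when m = 3 ^ k with
    k = 19 mod 20 it also has the same prime graph.  As there are many
    nonisomorphic groups K of order 3 ^ k, hOD ('Alt_('I_m)) is large.

    The prime graphs agree for the following reasons.  An even permutation of
    prime order p moves at least s points, where s = p for odd p and s = 4 for
    p = 2 (the [alt_support] of p).  Hence, when n > 6, distinct primes p and q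
    are adjacent in the graph of the alternating group of degree n exactly when
    alt_support p + alt_support q <= n ([prime_graph_Alt]).  Passing from m to
    m - 1 therefore removes only the edges with equality, and there are none:
    m is odd, so one of p and q would be 2 and the other m - 4, but 11 divides
    m - 4.  Multiplying by the 3-group K joins the vertex 3 to all the others
    and changes nothing else ([prime_graph_setX]); but 3 was joined to them
    already, because none of m, m - 1, m - 2 is prime (5 divides m - 2), so
    every prime q <= m satisfies q + 3 <= m.

    For K one takes the product of cyclic groups of orders 3 ^ i and
    3 ^ (k - i), with 2 * i <= k.  Since the alternating group of degree m - 1
    is centreless, the centre of the product has exponent 3 ^ (k - i), which
    recovers i. *)

(** * Points moved by even permutations *)

(** The least number of points moved by an even permutation of prime order p;
    an even involution has at least two 2-cycles. *)
Definition alt_support p := if p == 2 then 4 else p.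

Lemma leq_alt_support p : p <= alt_support p.
Proof. by rewrite /alt_support; case: eqP => [->|]. Qed.

(** A cycle of length p * q leaves enough room for disjoint supports, except for
    {p, q} = {2, 3}, where 4 + 3 > 6; this is why n > 6 is required. *)
Lemma leq_add_alt_support p q n :
    1 < p -> 1 < q -> p != q -> 6 < n -> p * q <= n ->
  alt_support p + alt_support q <= n.
Proof.
move=> p1 q1 ne_pq n6 le_pqn; rewrite /alt_support.
by case: (p =P 2) => ?; case: (q =P 2) => ?; nia.
Qed.

Definition moved (T : finType) (x : {perm T}) : {set T} := [set i | x i != i].

Lemma expg_porbit (T : finType) (x : {perm T}) i n :
  #|porbit x i| %| n -> (x ^+ n) i = i.
Proof.
case/dvdnP=> k ->; rewrite mulnC expgM.
have fix_i: (x ^+ #|porbit x i|) i = i by rewrite permX iter_porbit.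
by rewrite permX iter_fix.
Qed.

Lemma sub_porbit_moved (T : finType) (x : {perm T}) i :
  i \in moved x -> porbit x i \subset moved x.
Proof.
rewrite inE => xi; apply/subsetP=> _ /porbitP[k ->].
by rewrite inE -permM -expgSr expgS permM (inj_eq perm_inj).
Qed.

(** For odd p a nontrivial cycle already has p points.  For p = 2 the
    permutation cannot be a transposition, so after multiplication by its
    2-cycle (i  x i) it still moves some j, and i, x i, j, x j are distinct. *)
Lemma card_moved_prime (T : finType) (x : {perm T}) p :
  x \in 'Alt_T -> prime p -> #[x] = p -> alt_support p <= #|moved x|.
Proof.
rewrite Alt_even => ev_x pr_p ox.
have [i xi]: exists i, i \in moved x.
  apply/set0Pn; apply: contraTneq pr_p => x0.
  suffices x1: x = 1 by rewrite -ox x1 order1.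
  apply/permP=> i; apply/eqP; move/setP/(_ i): x0.
  by rewrite !inE perm1 => /negbFE.
rewrite /alt_support; case: eqP => [p2 | _]; last first.
  suffices <-: #|porbit x i| = p by apply/subset_leq_card/sub_porbit_moved.
  have: #|porbit x i| %| p by rewrite porbitE -ox; apply: dvdn_orbit.
  case/primeP: pr_p => _ /[apply] /orP[/eqP d1 | /eqP//].
  by move: xi; rewrite inE -{1}[x]expg1 expg_porbit ?d1 ?eqxx.
have xx j : x (x j) = j.
  by rewrite -permM -(expgS x 1) -{1}p2 -ox expg_order perm1.
have [j]: exists j, (tperm i (x i) * x) j != j.
  apply/existsP; apply: contraNT ev_x => /existsPn fix_all.
  suffices tx1: tperm i (x i) * x = 1.
    have := odd_permM (tperm i (x i)) x; rewrite tx1 odd_perm1 odd_tperm.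
    by move: xi; rewrite inE eq_sym => ->; case: odd_perm.
  by apply/permP=> j; rewrite perm1; apply/eqP; move: (fix_all j) => /negbNE.
rewrite permM.
case: tpermP => [->|->|/eqP ji /eqP jxi] xj; rewrite ?xx ?eqxx // in xj.
have xi' : x i != i by rewrite inE in xi.
pose s := [:: i; x i; j; x j].
have us : uniq s.
  rewrite /= !inE !negb_or eq_sym xi' (eq_sym i) ji (eq_sym (x i)) jxi.
  rewrite (eq_sym j) xj (inj_eq perm_inj) (eq_sym i j) ji.
  by rewrite -(inj_eq (@perm_inj _ x)) xx eq_sym jxi.
rewrite -[4]/(size s) -(card_uniqP us); apply/subset_leq_card/subsetP=> k.
by rewrite !inE => /or4P[] /eqP->; rewrite ?xx ?xi' ?xj // eq_sym.
Qed.

(** x ^+ p and x ^+ q are even of orders q and p.  Either they move disjoint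
    sets of points, or a point moved by both lies in an x-orbit whose length
    divides neither p nor q, hence is p * q. *)
Lemma Alt_order_mul_primes_leq (T : finType) (x : {perm T}) p q :
    x \in 'Alt_T -> prime p -> prime q -> p != q -> #[x] = (p * q)%N ->
  (alt_support p + alt_support q <= #|T|) || (p * q <= #|T|).
Proof.
move=> Ax pr_p pr_q ne_pq ox.
have Axp n : x ^+ n \in 'Alt_T by rewrite groupX.
have oxp : #[x ^+ p] = q.
  by rewrite orderXdiv ox ?dvdn_mulr // mulKn ?prime_gt0.
have oxq : #[x ^+ q] = p.
  by rewrite orderXdiv ox ?dvdn_mull // mulnK ?prime_gt0.
have [dis | /pred0Pn[i /andP[/= xqi xpi]]] :=
  boolP [disjoint moved (x ^+ q) & moved (x ^+ p)].
  apply/orP; left.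
  apply: leq_trans (max_card (moved (x ^+ q) :|: moved (x ^+ p))).
  by rewrite cardsU (disjoint_setI0 dis) cards0 subn0 leq_add ?card_moved_prime.
apply/orP; right; apply: leq_trans (max_card (porbit x i)).
apply: dvdn_leq; first by rewrite lt0n card_porbit_neq0.
have dvd_pq d r :
    prime d -> i \in moved (x ^+ r) -> #|porbit x i| %| d * r ->
  d %| #|porbit x i|.
  move=> pr_d; rewrite inE => xri.
  apply: contraLR => nd; apply: contra xri => dvd.
  by rewrite expg_porbit // -(@Gauss_dvdr _ d) // coprime_sym prime_coprime.
have dvd_orb : #|porbit x i| %| p * q by rewrite porbitE -ox; apply: dvdn_orbit.
rewrite Gauss_dvd; last by rewrite prime_coprime ?dvdn_prime2.
by rewrite (dvd_pq _ q) // (dvd_pq _ p) // mulnC.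
Qed.

(** By Cauchy's theorem it suffices that p divides the number of even
    permutations supported on A; these form at least half of the #|A|`!
    permutations supported on A, and 2 * p divides #|A|`!. *)
Lemma exists_Alt_prime_order_on (T : finType) (A : {set T}) p :
    prime p -> alt_support p <= #|A| ->
  exists x, [/\ x \in 'Alt_T, perm_on A x & #[x] = p].
Proof.
move=> pr_p leA; pose S := perm.Sym_group A.
have p2gt1 : 1 < alt_support p.
  exact: leq_trans (prime_gt1 pr_p) (leq_alt_support p).
have dvd2p : 2 * p %| #|A|`!.
  rewrite -(bin_fact leA) dvdn_mull // dvdn_mulr // /alt_support.
  case: eqP => [-> // | /eqP]; case: p pr_p {leA p2gt1} => // p pr_p p2.
  rewrite factS mulnC dvdn_mul // dvdn_fact //.
  by have := prime_gt1 pr_p; case: p pr_p p2 => [|[]].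
have T_gt1 : 1 < #|T| by apply: leq_trans p2gt1 (leq_trans leA (max_card _)).
have dvdp : p %| #|S :&: 'Alt_T|.
  rewrite -(@dvdn_pmul2l 2) //; apply: dvdn_trans dvd2p _.
  rewrite -(perm.card_Sym A) -(LagrangeI S 'Alt_T)%G mulnC dvdn_mul //.
  have: #|S : 'Alt_T| <= 2.
    by rewrite -(Alt_index T_gt1); apply/subset_leq_card/imsetS/subsetT.
  by have := indexg_gt0 S 'Alt_T; case: #|_ : _| => [|[|[]]].
have [x /setIP[Sx Ax] ox] := Cauchy pr_p dvdp.
by exists x; split=> //; rewrite inE in Sx.
Qed.

(** * The prime graph of an alternating group *)

Lemma prime_dvd_fact p n : prime p -> (p %| n`!) = (p <= n).
Proof.
move=> pr_p; apply/idP/idP => [|le_pn]; last by rewrite dvdn_fact ?prime_gt0.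
elim: n => [|n IHn]; first by rewrite dvdn1 => /eqP p1; rewrite p1 in pr_p.
by rewrite factS Euclid_dvdM // => /orP[/dvdn_leq->|/IHn/leqW].
Qed.

Lemma pi_Alt (T : finType) p :
  3 < #|T| -> (p \in \pi('Alt_T)) = prime p && (p <= #|T|).
Proof.
move=> T_gt3; rewrite mem_primes cardG_gt0 /=; case pr_p: (prime p) => //=.
have cA : (2 * #|'Alt_T|)%N = #|T|`! by rewrite card_Alt ?(ltn_trans _ T_gt3).
have [-> | p2] := eqVneq p 2.
  rewrite (ltn_trans _ T_gt3) // -(@dvdn_pmul2l 2) // cA.
  by rewrite -(bin_fact T_gt3) dvdn_mull // dvdn_mulr.
rewrite -(@Gauss_dvdr _ 2) ?cA ?prime_dvd_fact // prime_coprime //.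
by rewrite dvdn_prime2.
Qed.

(** Adjacency is witnessed by the product of two even permutations of orders p
    and q with disjoint supports. *)
Lemma prime_graph_Alt (T : finType) p q : 6 < #|T| ->
  prime_graph 'Alt_T p q =
    [&& prime p, prime q, p != q & alt_support p + alt_support q <= #|T|].
Proof.
move=> T_gt6; have T_gt3 : 3 < #|T| by apply: leq_trans T_gt6.
rewrite /prime_graph !pi_Alt //.
apply/idP/idP => [|/and4P[pr_p pr_q ne_pq le_pqT]].
  case/and4P=> /andP[pr_p _] /andP[pr_q _] ne_pq /exists_inP[x Ax /eqP ox].
  rewrite pr_p pr_q ne_pq /=; have := Alt_order_mul_primes_leq Ax pr_p pr_q ne_pq ox.
  by case/orP=> //; apply: leq_add_alt_support; rewrite ?prime_gt1.
have [le_p le_q] : p <= #|T| /\ q <= #|T|.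
  split; apply: leq_trans le_pqT.
    by rewrite (leq_trans (leq_alt_support p)) ?leq_addr.
  by rewrite (leq_trans (leq_alt_support q)) ?leq_addl.
rewrite pr_p pr_q ne_pq le_p le_q /=; apply/exists_inP.
pose A := [set x in take (alt_support p) (enum T)].
have oA : #|A| = alt_support p.
  rewrite cardsE; have /card_uniqP-> : uniq (take (alt_support p) (enum T)).
    by rewrite take_uniq ?enum_uniq.
  rewrite size_takel // -cardE; apply: leq_trans le_pqT; exact: leq_addr.
have oAC : alt_support q <= #|~: A|.
  by rewrite -(leq_add2l #|A|) cardsC oA.
have [|x [Ax xA ox]] := @exists_Alt_prime_order_on _ A _ pr_p; first by rewrite oA.
have [y [Ay yA oy]] := exists_Alt_prime_order_on pr_q oAC.
exists (x * y); first by rewrite groupM.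
have cxy : commute x y by apply: (perm_onC xA yA); rewrite -setI_eq0 setICr.
by rewrite (orderM cxy) ox oy ?prime_coprime ?dvdn_prime2.
Qed.

(** * Direct products with a group of prime power order *)

Lemma order_pair (gT rT : finGroupType) (x : gT) (y : rT) :
  #[(x, y)] = lcmn #[x] #[y].
Proof.
have pairX n : (x, y) ^+ n = (x ^+ n, y ^+ n).
  by elim: n => // n IHn; rewrite !expgS IHn.
apply/eqP; rewrite eqn_dvd dvdn_lcm !order_dvdn pairX.
have /eqP := expg_order (x, y); rewrite pairX => /eqP[-> ->].
rewrite !eqxx /= andbT.
by apply/eqP; congr (_, _); apply/eqP; rewrite -order_dvdn ?dvdn_lcml ?dvdn_lcmr.
Qed.

Lemma exponent_center_setX (gT rT : finGroupType) (A : {group gT})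
    (B : {group rT}) :
  exponent 'Z(setX A B) = lcmn (exponent 'Z(A)) (exponent 'Z(B)).
Proof.
rewrite -(dprod_exponent (center_dprod (setX_dprod A B))); congr lcmn.
  by rewrite -morphim_pairg1 -injm_center ?exponent_injm ?injm_pairg1 ?subsetT.
by rewrite -morphim_pair1g -injm_center ?exponent_injm ?injm_pair1g ?subsetT.
Qed.

Lemma center_Alt (T : finType) : 4 < #|T| -> 'Z('Alt_T) = 1.
Proof.
move=> T_gt4; have [_ simpA] := simpleP _ (simple_Alt5 T_gt4).
have [//|ZA] := simpA _ (center_normal 'Alt_T).
have: abelian 'Alt_T by rewrite -ZA center_abelian.
by move/abelian_sol; rewrite solvable_AltF.
Qed.

(** An element (a, b) of order p * q, with p and q different from r, has b = 1;
    conversely an element of order r in K commutes with all of A, so r becomes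
    adjacent to every other vertex. *)
Lemma prime_graph_setX (gT rT : finGroupType) (A : {group gT}) (K : {group rT})
    r p q : r \in \pi(A) -> r.-group K -> K :!=: 1 ->
  prime_graph (setX_group A K) p q = prime_graph A p q ||
    [&& p \in \pi(A), q \in \pi(A), p != q & (p == r) || (q == r)].
Proof.
move=> rA rK ntK.
have pr_r : prime r by move: rA; rewrite mem_primes => /and3P[].
have oX : #|setX_group A K| = (#|A| * #|K|)%N by apply: cardsX.
have piX s : (s \in \pi(setX_group A K)) = (s \in \pi(A)).
  have -> : (s \in \pi(setX_group A K)) = (s \in primes (#|A| * #|K|)).
    by rewrite -oX.
  rewrite !mem_primes muln_gt0 !cardG_gt0 /=; case pr_s: (prime s) => //=.
  rewrite Euclid_dvdM // orb_idr // => sK; have /eqnP-> := pgroupP rK _ pr_s sK.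
  by move: rA; rewrite mem_primes => /and3P[].
rewrite /prime_graph !piX; case pA: (p \in _) => //=; case qA: (q \in _) => //=.
case: (eqVneq p q) => //= ne_pq.
have [pr_p pr_q] : prime p /\ prime q.
  by move: pA qA; rewrite !mem_primes => /andP[-> _] /andP[-> _].
have mixed s : s \in \pi(A) -> s != r ->
    exists2 x, x \in setX_group A K & #[x] = (s * r)%N.
  rewrite mem_primes => /and3P[pr_s _ sA] sr.
  have [a Aa oa] := Cauchy pr_s sA.
  have [_ rK_dvd _] := pgroup_pdiv rK ntK; have [b Kb ob] := Cauchy pr_r rK_dvd.
  exists (a, b); first by rewrite inE Aa.
  have /eqP co_sr : coprime s r by rewrite prime_coprime ?dvdn_prime2.
  by rewrite order_pair oa ob -muln_lcm_gcd co_sr muln1.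
apply/exists_inP/orP => [[[a b]] | [/exists_inP[a Aa oa] | ]].
- rewrite inE order_pair => /andP[/= Aa Kb] /eqP oab.
  have [|/norP[pr qr]] := boolP ((p == r) || (q == r)); first by right.
  left; apply/exists_inP; exists a => //; suffices ob1: #[b] = 1%N.
    by rewrite -oab ob1 lcmn1.
  have rb : r.-nat #[b] := mem_p_elt rK Kb.
  apply/eqP; rewrite -dvdn1 -(@part_p'nat r (p * q)).
    rewrite -(part_pnat_id rb) partn_dvd ?muln_gt0 ?prime_gt0 //.
    by rewrite -oab dvdn_lcmr.
  by rewrite pnatM !pnatE // !inE pr.
- by exists (a, 1); rewrite ?inE ?Aa ?group1 // order_pair order1 lcmn1.
case/orP=> /eqP def_r; subst r.
  have [x Xx ox] := mixed q qA (negbT (etrans (eq_sym _ _) (negbTE ne_pq))).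
  by exists x; rewrite // ox mulnC.
by have [x Xx ox] := mixed p pA ne_pq; exists x; rewrite // ox.
Qed.

(** * Groups with the degree pattern of an alternating group *)

Lemma leq_hOD (gT : finGroupType) (H : {group gT}) N
    (U : 'I_N -> finGroupType) (G : forall i, {group U i}) :
    (forall i, same_OD (G i) H) -> (forall i j, G i \isog G j -> i = j) ->
  N <= hOD H.
Proof.
move=> odG irrG; have [T [K [_ _ fullK]]] := OD_class_count_hOD H.
pose f i := xchoose (fullK _ _ (odG i)).
rewrite -(card_ord N) -(card_ord (hOD H)).
apply: (@leq_card _ _ f) => i j fij.
have isoi := xchooseP (fullK _ _ (odG i)).
have isoj := xchooseP (fullK _ _ (odG j)).
apply: irrG; rewrite -/(f i) in isoi; rewrite -/(f j) -fij in isoj.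
by apply: isog_trans isoi _; rewrite isog_sym.
Qed.

Lemma eq_degree_pattern (gT rT : finGroupType) (G : {group gT})
    (H : {group rT}) :
    #|G| = #|H| -> prime_graph G =2 prime_graph H ->
  degree_pattern G = degree_pattern H.
Proof.
move=> oGH eqGH; rewrite /degree_pattern /pg_degree oGH.
by apply: eq_map => p; apply: eq_count => q; apply: eqGH.
Qed.

(** The gap above the largest prime up to m ensures that r is adjacent to every
    other vertex in the graph of 'Alt_('I_m), so that the edges created by K are
    not new; oddness of m and compositeness of m - 4 ensure that no edge
    depends on the last point. *)
Lemma same_OD_Alt_setX (rT : finGroupType) (K : {group rT}) m r :
    7 < m -> odd m -> #|K| = m -> prime r -> r.-group K ->
    (forall s, prime s -> s <= m -> s + r <= m) -> ~~ prime (m - 4) ->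
  same_OD (setX_group 'Alt_('I_m.-1) K) 'Alt_('I_m).
Proof.
move=> m_gt7 odd_m oK pr_r rK gap npr_m4.
have m_gt1 : 1 < m by apply: ltn_trans m_gt7.
have le5r : 5 + r <= m by rewrite gap // (ltn_trans _ m_gt7).
have m1_gt6 : 6 < m.-1 by lia.
have pi_m1 p : (p \in \pi('Alt_('I_m.-1))) = prime p && (p <= m.-1).
  by rewrite pi_Alt card_ord // (ltn_trans _ m1_gt6).
have oG : #|setX_group 'Alt_('I_m.-1) K| = #|'Alt_('I_m)|.
  apply/eqP; rewrite -(@eqn_pmul2l 2) // card_Alt card_ord //.
  rewrite -[#|setX_group _ _|]/(#|setX 'Alt_('I_m.-1) K|) cardsX oK mulnA.
  rewrite card_Alt card_ord ?(ltn_trans _ m1_gt6) // mulnC.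
  by case: (m) m_gt1.
rewrite /same_OD oG eqxx (eq_degree_pattern oG) //= => p q.
have ntK : K :!=: 1 by rewrite -cardG_gt1 oK.
rewrite (prime_graph_setX (r := r)) //; last first.
- by rewrite pi_m1 pr_r; lia.
rewrite !prime_graph_Alt ?card_ord ?(ltn_trans _ m_gt7) // !pi_m1.
case pr_p: (prime p) => //=; case pr_q: (prime q); rewrite ?andbF //=.
have [->|ne_pq /=] := eqVneq p q; first by rewrite !andbF.
have [_ r_dvd _] := pgroup_pdiv rK ntK.
have odd_r : odd r by apply: dvdn_odd odd_m; rewrite -oK.
have alt_gap s :
    prime s -> s <= m.-1 -> s != r -> alt_support s + alt_support r <= m.
  move=> pr_s le_s ne_sr; have := gap s pr_s; rewrite /alt_support.
  case: (r =P 2) => [r2|_]; first by rewrite r2 in odd_r.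
  (* For s = 2 the bound 4 + r <= m comes from the gap at the prime 5. *)
  by case: (s =P 2) => _; lia.
have no_eq : alt_support p + alt_support q != m.
  apply: contraNneq npr_m4; rewrite /alt_support => def_m.
  have [[p2|odd_p] [q2|odd_q]] := (even_prime pr_p, even_prime pr_q).
  - by rewrite p2 q2 in ne_pq.
  - by rewrite -def_m p2 /= addKn; case: (q =P 2) odd_q => [->|].
  - by rewrite -def_m q2 /= addnK; case: (p =P 2) odd_p => [->|].
  - move: odd_m; rewrite -def_m; case: eqP odd_p => [->//|_ odd_p].
    by case: eqP odd_q => [->//|_ odd_q]; rewrite oddD odd_p odd_q.
have [le_p le_q] := (leq_alt_support p, leq_alt_support q).
have [p1 q1] := (prime_gt1 pr_p, prime_gt1 pr_q).
apply/idP/idP => [/orP[|/and3P[le_pm le_qm /orP[]/eqP def_r]]|]; try lia.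
- by rewrite addnC def_r alt_gap // -def_r eq_sym.
- by rewrite def_r alt_gap // -def_r.
Qed.

Lemma exponent_center_ZpX a b :
  0 < a -> 0 < b -> exponent 'Z(setX (Zp a) (Zp b)) = lcmn a b.
Proof.
have exp_Zp n : 0 < n -> exponent 'Z(Zp n) = n.
  move=> n_gt0; have cycZ : cyclic (Zp n).
    rewrite /Zp; case: ifP => _; last exact: cyclic1.
    by rewrite Zp_cycle cycle_cyclic.
  by rewrite (center_idP (cyclic_abelian cycZ)) exponent_cyclic ?card_Zp.
by move=> a_gt0 b_gt0; rewrite exponent_center_setX !exp_Zp.
Qed.

Lemma dvdn_not_prime d n : prime d -> d %| n -> d < n -> ~~ prime n.
Proof.
move=> pr_d d_n lt_dn; apply: contraTN d_n => pr_n.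
by rewrite dvdn_prime2 // ltn_eqF.
Qed.

(** The exponents k = 19 mod 20 are those with 3 ^ k = 3 ^ 3 = 2 mod 5 and
    3 ^ k = 3 ^ 4 = 4 mod 11, as 3 has order 4 mod 5 and order 5 mod 11. *)
Lemma same_OD_Alt_exp3 (rT : finGroupType) (K : {group rT}) N :
    let m := (3 ^ (20 * N + 19))%N in
  #|K| = m -> same_OD (setX_group 'Alt_('I_m.-1) K) 'Alt_('I_m).
Proof.
move=> m oK.
have m_gt26 : 26 < m by rewrite -[26.+1]/((3 ^ 3)%N) leq_exp2l //; lia.
have odd_m : odd m by rewrite oddX orbT.
have dvd5 : 5 %| m - 2.
  rewrite -eqn_mod_dvd ?(ltn_trans _ m_gt26) // /m.
  have ->: (20 * N + 19 = 4 * (5 * N + 4) + 3)%N by lia.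
  by rewrite expnD expnM -modnMml -modnXm (_ : 3 ^ 4 %% 5 = 1)%N // exp1n.
have dvd11 : 11 %| m - 4.
  rewrite -eqn_mod_dvd ?(ltn_trans _ m_gt26) // /m.
  have ->: (20 * N + 19 = 5 * (4 * N + 3) + 4)%N by lia.
  by rewrite expnD expnM -modnMml -modnXm (_ : 3 ^ 5 %% 11 = 1)%N // exp1n.
have npr_m : ~~ prime m.
  by rewrite (@dvdn_not_prime 3) ?dvdn_exp ?addn_gt0 ?orbT ?(ltn_trans _ m_gt26).
have npr_m2 : ~~ prime (m - 2) by rewrite (dvdn_not_prime _ dvd5) //; lia.
apply: (@same_OD_Alt_setX _ _ _ 3); rewrite ?(ltn_trans _ m_gt26) //.
- by rewrite /pgroup oK pnatX pnat_id.
- move=> s pr_s le_s; rewrite leqNgt.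
  apply/negP=> lt_ms; have: s \in [:: m; m.-1; m - 2] by rewrite !inE; lia.
  rewrite !inE => /or3P[]/eqP def_s.
  + by rewrite -def_s pr_s in npr_m.
  + have [s2|] := even_prime pr_s; first by lia.
    by rewrite def_s -subn1 oddB ?odd_m //; lia.
  + by rewrite -def_s pr_s in npr_m2.
- by rewrite (dvdn_not_prime _ dvd11) //; lia.
Qed.

Theorem theorem1p6 :
  (forall n : nat, exists m : nat, n < m /\ 1 < hOD (Alt_group 'I_m)) /\
  (forall N : nat, exists m : nat, N < hOD (Alt_group 'I_m)).
Proof.
pose k N := (20 * N + 19)%N.
have many N : N < hOD (Alt_group 'I_(3 ^ k N)).
  pose K (i : 'I_N.+1) :=
    setX_group (Zp_group (3 ^ i)) (Zp_group (3 ^ (k N - i))).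
  have le_i (i : 'I_N.+1) : i <= k N - i by have := ltn_ord i; rewrite /k; lia.
  have oK i : #|K i| = (3 ^ k N)%N.
    rewrite -[#|K i|]/(#|setX (Zp _) (Zp _)|) cardsX !card_Zp ?expn_gt0 //.
    rewrite -expnD subnKC //.
    by have := le_i i; lia.
  have expZ i :
    exponent 'Z(setX_group 'Alt_('I_(3 ^ k N).-1) (K i)) = (3 ^ (k N - i))%N.
    rewrite exponent_center_setX center_Alt; last first.
      by rewrite card_ord; have := @leq_exp2l 3 3 (k N); rewrite /k; lia.
    rewrite exponent1 lcm1n exponent_center_ZpX ?expn_gt0 //; apply/lcmn_idPr.
    by rewrite dvdn_exp2l.
  apply: (leq_hOD (G := fun i => setX_group 'Alt_('I_(3 ^ k N).-1) (K i))).
    by move=> i; apply: same_OD_Alt_exp3 (oK i).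
  move=> i j /isog_center/exponent_isog; rewrite !expZ => /eqP.
  rewrite eqn_exp2l // => /eqP eq_ij.
  by apply/val_inj; move: (le_i i) (le_i j) eq_ij => /=; lia.
split=> [n | N]; last by exists (3 ^ k N)%N.
exists (3 ^ k n.+1)%N; split; last exact: leq_trans (many _).
by apply: leq_trans (ltn_expl (k n.+1) _); rewrite // /k; lia.
Qed.
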